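(* Let $M=(E,\mathcal I)$ be a matroid with base family $\mathcal B$, and let $\widetilde{\mathcal B}$ be a Fulkerson dual family of $\mathcal B$. Let $p\in(1,\infty)\setminus\{2\}$ and let $q=p/(p-1)$ be its Hölder conjugate. Then $\mathrm{Mod}_2(\widetilde{\mathcal B})$ and $\mathrm{Mod}_q(\widetilde{\mathcal B})$ have the same optimal density.
   Context: A matroid $M=(E,\mathcal I)$ on a finite set $E$ has rank function $r$ and base family $\mathcal B$. Standing assumption: all matroids are loopless (every singleton independent) with $r(E)>0$. Bases are identified with indicator vectors. For $\Gamma\subseteq\mathbb R^E_{\ge0}$, $\mathrm{Adm}(\Gamma)=\{\rho\in\mathbb R^E_{\ge0}:\sum_e\gamma(e)\rho(e)\ge1\ \forall\gamma\in\Gamma\}$ and, for $1<s<\infty$, $\mathrm{Mod}_s(\Gamma)=\min\{\sum_{e\in E}\rho(e)^s:\rho\in\mathrm{Adm}(\Gamma)\}$, whose minimizer (optimal density) exists and is unique. $\mathrm{BL}(K)=\{\eta\ge0:\eta^T\rho\ge1\ \forall\rho\in K\}$; $\widetilde{\mathcal B}\subseteq\mathbb R^E_{\ge0}$ is a Fulkerson dual family of $\mathcal B$ if $\mathrm{Adm}(\widetilde{\mathcal B})=\mathrm{BL}(\mathrm{Adm}(\mathcal B))$. *)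

(* Defs.v *)
From HB Require Import structures.
From mathcomp Require Import all_boot all_order all_algebra.
From mathcomp Require Import all_classical all_reals all_analysis.

Set Implicit Arguments.
Unset Strict Implicit.
Unset Printing Implicit Defensive.

Import Order.TTheory GRing.Theory Num.Theory.
Local Open Scope classical_set_scope.
Local Open Scope ring_scope.

Record matroid (E : finType) := Matroid {
  indep : {set {set E}};
  indep0 : finset.set0 \in indep;
  indepS : forall I J : {set E}, I \subset J -> J \in indep -> I \in indep;
  indep_aug : forall I J : {set E}, I \in indep -> J \in indep ->
    (#|I| < #|J|)%N -> exists2 e : E, e \in J :\: I & e |: I \in indep
}.

Definition mrank (E : finType) (M : matroid E) (A : {set E}) : nat :=
  (\max_(I in indep M | I \subset A) #|I|)%N.

Definition loopless (E : finType) (M : matroid E) : Prop :=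
  forall e : E, finset.set1 e \in indep M.

Definition bases (E : finType) (M : matroid E) : {set {set E}} :=
  finset.finset (maxset (fun I => I \in indep M)).

Definition indicator (R : realType) (E : finType) (A : {set E}) : E -> R :=
  fun e => (e \in A)%:R.

Definition base_family (R : realType) (E : finType) (M : matroid E) :
    set (E -> R) :=
  [set indicator R B | B in [set B : {set E} | B \in bases M]].
Arguments base_family R {E} M _.

Definition nonneg_orthant (R : realType) (E : finType) : set (E -> R) :=
  [set v | forall e, 0 <= v e].
Arguments nonneg_orthant : clear implicits.

Definition Adm (R : realType) (E : finType) (G : set (E -> R)) : set (E -> R) :=
  [set rho | nonneg_orthant R E rho /\
             forall g, G g -> 1 <= \sum_(e : E) g e * rho e].

Definition BL (R : realType) (E : finType) (K : set (E -> R)) : set (E -> R) :=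
  [set eta | nonneg_orthant R E eta /\
             forall rho, K rho -> 1 <= \sum_(e : E) eta e * rho e].

Definition fulkerson_dual (R : realType) (E : finType) (G Gd : set (E -> R)) :
    Prop :=
  Gd `<=` nonneg_orthant R E /\ Adm Gd = BL (Adm G).

Definition energy (R : realType) (E : finType) (s : R) (rho : E -> R) : R :=
  \sum_(e : E) rho e `^ s.

(* Since [inf] is total, Mod is meaningful only when Adm G is nonempty; that the
   infimum is a minimum is not built in here but is what [optimal_density]
   requires of its argument. *)
Definition Mod (R : realType) (E : finType) (s : R) (G : set (E -> R)) : R :=
  inf [set energy s rho | rho in Adm G].

Definition optimal_density (R : realType) (E : finType) (s : R)
    (G : set (E -> R)) (rho : E -> R) : Prop :=
  Adm G rho /\ energy s rho = Mod s G.

(* Main.v *)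
Require Import Defs.
From HB Require Import structures.
From mathcomp Require Import all_boot all_order all_algebra.
From mathcomp Require Import all_classical all_reals all_analysis.
From mathcomp Require Import ring lra.

Set Implicit Arguments.
Unset Strict Implicit.
Unset Printing Implicit Defensive.

Import Order.TTheory GRing.Theory Num.Theory.
Import numFieldNormedType.Exports.
Local Open Scope classical_set_scope.
Local Open Scope ring_scope.

(** Let [K] be the admissible set of the dual family and [eta] its point of
    least 2-energy, regarded as a weight on the ground set. The indicator [1_B]
    of a base [B] of least [eta]-weight lies in [K], and by the exchange property
    [B] meets every upper level set [U] of [eta] in as few elements as any base
    can; hence [x(U) >= 1_B(U)] for all [x] in [K]. Writing increasing functions
    as conic combinations of indicators of upper level sets, [phi(eta).x >=
    phi(eta).1_B] for every increasing [phi >= 0]. Optimality of [eta] gives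
    [eta.eta <= eta.1_B], so [eta] and [1_B] agree on all positive upper level
    sets and [phi(eta).eta <= phi(eta).1_B <= phi(eta).x] if [phi 0 = 0]. For
    [phi t = t^(s-1)] this is the first-order optimality condition of the strictly
    convex [s]-energy, so [eta] is its unique minimizer on [K] for all [s > 1]. *)

(** * Matroid bases: exchange and bases of least weight *)

Section Matroids.
Variables (E : finType) (M : matroid E).
Implicit Types B I J L U : {set E}.

Lemma bases_indep B : B \in bases M -> B \in indep M.
Proof. by rewrite finset.inE => /maxsetp. Qed.

Lemma indep_card_bases I B : I \in indep M -> B \in bases M -> (#|I| <= #|B|)%N.
Proof.
move=> indepI basB; rewrite leqNgt; apply/negP => ltBI.
have [e] := indep_aug (bases_indep basB) indepI ltBI.
rewrite finset.inE => /andP[eNB _] indepeB.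
move: basB; rewrite finset.inE => /maxsetP[_ /(_ _ indepeB (finset.subsetUr _ _)) eB].
by move: eNB; rewrite -eB finset.setU11.
Qed.

Lemma card_bases B B' : B \in bases M -> B' \in bases M -> #|B| = #|B'|.
Proof.
by move=> hB hB'; apply/eqP; rewrite eqn_leq !indep_card_bases// bases_indep.
Qed.

Lemma bases_card J B :
  J \in indep M -> B \in bases M -> #|J| = #|B| -> J \in bases M.
Proof.
move=> indepJ basB cardJ; rewrite finset.inE; apply/maxsetP; split=> // I indepI sJI.
by apply/esym/eqP; rewrite eqEcard sJI cardJ indep_card_bases.
Qed.

Lemma bases_nonempty : exists B, B \in bases M.
Proof.
have [B maxB _] := maxset_exists (P := fun I => I \in indep M) (indep0 M).
by exists B; rewrite finset.inE.
Qed.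

(** A maximal independent set between [I] and [I :|: B] is as large as [B]: otherwise augmentation
    from [B] would enlarge it inside [I :|: B]. *)
Lemma bases_between I B : I \in indep M -> B \in bases M ->
  exists J, [/\ J \in bases M, I \subset J & J \subset I :|: B].
Proof.
move=> indepI basB.
pose P J := (J \in indep M) && (J \subset I :|: B).
have PI : P I by rewrite /P indepI finset.subsetUl.
have [J /maxsetP[/andP[indepJ sJIB] maxJ] sIJ] := maxset_exists PI.
exists J; split=> //; apply: (bases_card indepJ basB); apply/eqP.
rewrite eqn_leq indep_card_bases//= leqNgt; apply/negP => ltJB.
have [e] := indep_aug indepJ (bases_indep basB) ltJB.
rewrite finset.inE => /andP[eNJ eB] indepeJ.
have eJ : e |: J = J.
  apply: maxJ (finset.subsetUr _ _).
  by rewrite /P indepeJ finset.subUset finset.sub1set finset.inE eB orbT.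
by move: eNJ; rewrite -eJ finset.setU11.
Qed.

(** Augment [B :&: L] by some [e] of [B' :&: L] and complete it to a base [J] inside [e |: B]. By
    cardinality [J] omits exactly one [f] of [B], and [f] is outside [L] because [J] contains
    [B :&: L]. *)
Lemma base_exchange B B' L : B \in bases M -> B' \in bases M ->
    (#|B :&: L| < #|B' :&: L|)%N ->
  exists e f, [/\ e \in L, e \notin B, f \in B :\: L & e |: (B :\ f) \in bases M].
Proof.
move=> basB basB' ltL.
have indepBL : B :&: L \in indep M.
  exact: indepS (finset.subsetIl _ _) (bases_indep basB).
have indepB'L : B' :&: L \in indep M.
  exact: indepS (finset.subsetIl _ _) (bases_indep basB').
have [e] := indep_aug indepBL indepB'L ltL.
rewrite !finset.inE => /andP[+ /andP[_ eL]]; rewrite eL andbT => eNB indepI.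
have [J [basJ sIJ sJIB]] := bases_between indepI basB.
have eJ : e \in J by apply: (fintype.subsetP sIJ); rewrite finset.setU11.
have sJeB : J \subset e |: B.
  apply: (fintype.subset_trans sJIB); rewrite finset.subUset finset.subsetUr andbT.
  by apply: finset.setUS; apply: finset.subsetIl.
have cardJ := card_bases basJ basB.
have : ~~ (B \subset J).
  apply/negP => sBJ; have /eqP BJ : B == J by rewrite eqEcard sBJ cardJ leqnn.
  by move: eNB; rewrite BJ eJ.
move=> /subsetPn[f fB fNJ].
exists e, f; split=> //.
  rewrite finset.inE fB andbT; apply/negP => fL; case/negP: fNJ.
  by apply: (fintype.subsetP sIJ); rewrite !finset.inE fB fL orbT.
suff -> : e |: (B :\ f) = J by [].
apply/esym/eqP; rewrite eqEcard; apply/andP; split.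
  apply/fintype.subsetP => x xJ; move: (fintype.subsetP sJeB _ xJ).
  rewrite !finset.inE => /orP[->//|->]; rewrite andbT.
  by case: (eqVneq x f) => [xf|]; [move: fNJ; rewrite -xf xJ | rewrite orbT].
by rewrite cardsU1 !finset.inE (negPf eNB) andbF cardJ (cardsD1 f B) fB.
Qed.

(** A base of least weight serves all thresholds at once. If it met an upper level set in more
    elements than [B'], it would meet the complement in fewer; an exchange would then replace an
    element of weight at least [t] by one of weight below [t]. *)
Lemma min_weight_base (R : realType) (w : E -> R) : exists2 B, B \in bases M &
  forall (t : R) B', B' \in bases M ->
    (#|B :&: [set e | (t <= w e)%R]%SET| <= #|B' :&: [set e | (t <= w e)%R]%SET|)%N.
Proof.
have [B0 basB0] := bases_nonempty.
have [B basB minB] :=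
  @arg_minP _ R _ B0 (mem (bases M)) (fun B => \sum_(e in B) w e) basB0.
exists B => // t B' basB'.
set U := [set e | (t <= w e)%R]%SET; rewrite leqNgt; apply/negP => ltU.
have : (#|B :&: ~: U| < #|B' :&: ~: U|)%N.
  rewrite -!finset.setDE -(ltn_add2l #|B' :&: U|) cardsID -(card_bases basB basB').
  by rewrite -(cardsID U B) ltn_add2r.
move=> /(base_exchange basB basB')[e [f [eL eNB fBL basB1]]].
move: fBL eL; rewrite !finset.inE negbK -ltNge => /andP[tf fB] et.
have := minB _ basB1.
rewrite big_setU1 ?finset.inE ?(negPf eNB) ?andbF//= (big_setD1 f fB)/= lerD2r.
by move=> /(le_trans tf)/le_lt_trans/(_ et); rewrite ltxx.
Qed.

End Matroids.

(** * Strict convexity of powers, and sums against monotone functions *)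

Section Reals.
Variable R : realType.

(** For positive [a] and [b], writing [a = b * expR u] and dividing by [b^s] leaves
    [s * e^u < e^(s*u) + s - 1], which follows from [1 + v < e^v] at [v = (s - 1) * u] and
    [v = - u]. The cases [b = 0] and [a = 0] are treated directly. *)
Lemma powR_gt_tangent (s a b : R) : 1 < s -> 0 <= a -> 0 <= b -> a != b ->
  b `^ s + s * b `^ (s - 1) * (a - b) < a `^ s.
Proof.
move=> s1 a0 b0 ab.
have s0 : 0 < s by apply: lt_trans s1.
have s10 : s - 1 != 0 by rewrite subr_eq0 gt_eqF.
have [b00|bn0] := eqVneq b 0.
  rewrite b00 (powR0 s10) powR0 ?gt_eqF// mulr0 mul0r addr0 powR_gt0//.
  by rewrite lt_neqAle a0 andbT eq_sym -b00.
have bgt : 0 < b by rewrite lt_neqAle b0 eq_sym bn0.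
have bs : b `^ s = b * b `^ (s - 1) by rewrite mulr_powRB1.
have cgt : 0 < b `^ (s - 1) by apply: powR_gt0.
have [a00|an0] := eqVneq a 0.
  rewrite a00 powR0 ?gt_eqF// bs -subr_gt0.
  rewrite (_ : _ - _ = b * b `^ (s - 1) * (s - 1)); last by ring.
  by rewrite !mulr_gt0// subr_gt0.
have agt : 0 < a by rewrite lt_neqAle a0 eq_sym an0.
pose u := ln (a / b).
have eu : a = b * expR u by rewrite /u lnK ?posrE ?divr_gt0// mulrCA divff ?mulr1.
have un0 : u != 0.
  by apply/eqP => u0; move: ab; rewrite eu u0 expR0 mulr1 eqxx.
rewrite eu powRM ?expR_ge0// -expRM bs.
have -> : expR (u * s) = expR u * expR ((s - 1) * u) by rewrite -expRD; congr expR; ring.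
have E1 : 1 + (s - 1) * u < expR ((s - 1) * u) by rewrite expR_gt1Dx// mulf_neq0.
have E2 : 1 - u < expR (- u) by rewrite expR_gt1Dx ?oppr_eq0.
have E3 : expR u * expR (- u) = 1 by rewrite -expRD subrr expR0.
have := expR_gt0 u.
move: E1 E2 E3; set x := expR _; set y := expR (- u); set z := expR u.
move=> E1 E2 E3 z0.
suff : z * s < z * x + (s - 1).
  move=> h; rewrite -subr_gt0.
  have -> : b * b `^ (s - 1) * (z * x) -
            (b * b `^ (s - 1) + s * b `^ (s - 1) * (b * z - b)) =
            (b * b `^ (s - 1)) * (z * x + (s - 1) - z * s) by ring.
  by rewrite mulr_gt0 ?subr_gt0// mulr_gt0.
(* Cancelling [z] leaves [s < x + (s - 1) * y]: in [E1] plus [s - 1] times [E2] the terms in [u]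
   cancel. *)
rewrite -[X in _ + X]mulr1 -E3 mulrCA -mulrDr ltr_pM2l//.
by nra.
Qed.

Lemma ler_sum_term (E : finType) (F : E -> R) :
  (forall e, 0 <= F e) -> forall e, F e <= \sum_e F e.
Proof. by move=> F0 e; rewrite (bigD1 e)//= lerDl sumr_ge0. Qed.

Section Monotone.
Variables (E : finType) (w d : E -> R).
Hypothesis d_ge0 : forall t, 0 <= \sum_(e | t <= w e) d e.

(* Layer-cake decomposition: a nonnegative function that increases with [w] is
   a conic combination of indicators of upper level sets of [w]. *)
Lemma sum_monotone_ge0 (g : E -> R) : (forall e, 0 <= g e) ->
  (forall e f, w e <= w f -> g e <= g f) -> 0 <= \sum_e g e * d e.
Proof.
have [n] := ubnP #|[pred e | g e != 0]|.
elim: n g => // n IHn g; rewrite ltnS => leg g0 gw.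
have [/existsP[e1 ge1]|/existsPn gz] := boolP [exists e, g e != 0]; last first.
  by rewrite big1// => e _; have := gz e; rewrite negbK => /eqP ->; rewrite mul0r.
have [e0 /= ge0 minw] := @arg_minP _ R _ e1 (fun e => g e != 0) w ge1.
have wg e : (w e0 <= w e) = (g e != 0).
  apply/idP/idP => [/gw h|/minw//].
  by rewrite gt_eqF// (lt_le_trans _ h)// lt_neqAle eq_sym ge0 g0.
(* The support of [g] is exactly the level set above [w e0]. Peeling off the constant [g e0] there
   removes [e0] from the support and keeps monotonicity. *)
pose h e := if w e0 <= w e then g e - g e0 else 0.
have -> : \sum_e g e * d e = g e0 * (\sum_(e | w e0 <= w e) d e) + \sum_e h e * d e.
  rewrite mulr_sumr [X in X + _]big_mkcond -big_split/=; apply: eq_bigr => e _.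
  rewrite /h; case: ifP => we; first by ring.
  by move/negbT: we; rewrite wg negbK => /eqP ->; rewrite !mul0r addr0.
rewrite addr_ge0 ?mulr_ge0//; apply: IHn.
- apply: leq_trans leg; apply: proper_card; apply/properP; split.
    apply/fintype.subsetP => e; rewrite !inE /h wg.
    by case: (eqVneq (g e) 0) => [->|//]; rewrite eqxx.
  by exists e0; rewrite !inE// /h lexx subrr eqxx.
- by move=> e; rewrite /h; case: ifP => // /gw; rewrite subr_ge0.
- move=> e f ef; rewrite /h; case: ifP => we; last first.
    by case: ifP => // /gw; rewrite subr_ge0.
  by rewrite (le_trans we ef) lerD2r gw.
Qed.

(* [c * w - g] is again nonnegative and increasing in [w] once [c] dominates the
   slopes of [g] as a function of [w]. *)
Lemma sum_monotone_le0 (g : E -> R) : (forall e, 0 <= w e) ->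
    (forall e, w e = 0 -> g e = 0) -> (forall e f, w e = w f -> g e = g f) ->
    \sum_e w e * d e <= 0 ->
  \sum_e g e * d e <= 0.
Proof.
move=> w0 gw0 gw wd.
(* Sums stand in for maxima. The first bounds slopes from the origin, for nonnegativity of
   [c * w - g]; the second bounds slopes between values of [w], for its monotonicity. Quotients by
   zero are 0. *)
pose c : R := \sum_e `|g e / w e| + \sum_e \sum_f `|(g f - g e) / (w f - w e)|.
have c1 e : `|g e / w e| <= c.
  rewrite /c -[leLHS]addr0 lerD ?sumr_ge0//; last first.
    by move=> k _; rewrite sumr_ge0.
  by apply: (ler_sum_term (F := fun e => `|g e / w e| : R)) => k; exact: normr_ge0.
have c2 e f : `|(g f - g e) / (w f - w e)| <= c.
  rewrite /c -[leLHS]add0r lerD ?sumr_ge0//.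
  pose G e f : R := `|(g f - g e) / (w f - w e)|.
  have G0 k l : 0 <= G k l by exact: normr_ge0.
  rewrite (le_trans (ler_sum_term (G0 e) f))//.
  by apply: (ler_sum_term (F := fun e => \sum_f G e f)) => k; rewrite sumr_ge0.
have : 0 <= \sum_e (c * w e - g e) * d e.
  apply: sum_monotone_ge0 => [e|e f].
    have [we0|wen0] := eqVneq (w e) 0; first by rewrite we0 mulr0 gw0// subrr.
    have wgt : 0 < w e by rewrite lt_neqAle eq_sym wen0 w0.
    by rewrite subr_ge0 -ler_pdivrMr// (le_trans _ (c1 e))// ler_norm.
  rewrite le_eqVlt => /predU1P[wef|wef]; first by rewrite wef (gw _ _ wef).
  have {}wef : 0 < w f - w e by rewrite subr_gt0.
  have := le_trans (ler_norm _) (c2 e f); rewrite ler_pdivrMr// mulrBr.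
  by move=> h; lra.
under eq_bigr do rewrite mulrBl -mulrA.
rewrite sumrB -mulr_sumr subr_ge0 => /le_trans; apply.
rewrite mulr_ge0_le0// /c addr_ge0// sumr_ge0// => e _.
by rewrite sumr_ge0.
Qed.

End Monotone.

End Reals.

(** * The point of least 2-energy: existence and variational inequality *)

Section Minimizer.
Variables (R : realType) (E : finType).
(** Pointwise convergence is the product topology, in which boxes are compact by Tychonoff. *)
Local Notation X := {ptws E -> R}.

Lemma continuous_ptws_sum (F : E -> R -> R) : (forall e, continuous (F e)) ->
  continuous (fun x : X => \sum_e F e (x e)).
Proof.
move=> Fc; apply: continuous_big; first exact: add_continuous.
move=> e _ x; apply: (@continuous_comp X R R (fun y : X => y e) (F e)).
  exact: (@proj_continuous E (fun=> R) e).
exact: Fc.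
Qed.

Lemma closed_BL (K : set (E -> R)) : closed (BL K : set X).
Proof.
have -> : (BL K : set X) = (\bigcap_(e in [set: E]) (fun x : X => x e) @^-1` [set y : R | 0 <= y])
    `&` \bigcap_(rho in K) (fun x : X => \sum_e x e * rho e) @^-1` [set y : R | 1 <= y].
  apply/seteqP; split=> x [x0 xK]; split.
  - by move=> e _; exact: x0.
  - by move=> rho; exact: xK.
  - by move=> e; exact: x0.
  - by move=> rho; exact: xK.
apply: closedI; apply: closed_bigI => i Ki.
  apply: preimage_closed; last exact: closed_ge.
  by move=> x _; exact: (@proj_continuous E (fun=> R) i).
apply: preimage_closed; last exact: closed_ge.
move=> x _; apply: (continuous_ptws_sum (F := fun e y => y * i e)) => e.
exact: mulrr_continuous.
Qed.

Lemma BL_energy2_min (K : set (E -> R)) : BL K !=set0 ->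
  exists2 eta, BL K eta & forall x, BL K x -> \sum_e eta e ^+ 2 <= \sum_e x e ^+ 2.
Proof.
move=> [x0 Kx0].
(* The added 1 makes a coordinate above [N] exceed 1, so its square exceeds it and hence the energy
   of [x0]. *)
pose N : R := 1 + \sum_e x0 e ^+ 2.
have N1 : 1 <= N by rewrite lerDl sumr_ge0// => e _; exact: sqr_ge0.
pose box : set X := [set x : E -> R | forall e, `[0, N]%classic (x e)].
have smallP x : BL K x -> \sum_e x e ^+ 2 <= \sum_e x0 e ^+ 2 -> box x.
  move=> Kx xx0 e; rewrite /= in_itv/= (Kx.1 e)/= leNgt; apply/negP => Nx.
  have := ler_sum_term (fun e => sqr_ge0 (x e)) e.
  move=> /le_trans/(_ xx0); apply/negP; rewrite -ltNge.
  have xe : \sum_e x0 e ^+ 2 < x e by apply: lt_trans Nx; rewrite /N ltrDr.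
  have x1 : 1 < x e by apply: le_lt_trans Nx.
  by apply: (lt_trans xe); rewrite expr2 ltr_pMr// (lt_trans ltr01).
have box_compact : @compact X box.
  by apply: (@tychonoff E (fun=> R) (fun=> `[0, N]%classic)) => e; exact: segment_compact.
have cA : @compact X (box `&` (BL K : set X)).
  by apply: (@compact_closedI X); [exact: box_compact | exact: closed_BL].
have A0 : box `&` (BL K : set X) !=set0 by exists x0; split=> //; exact: smallP.
have cf : continuous (fun x : X => \sum_e x e ^+ 2).
  by apply: (continuous_ptws_sum (F := fun=> fun y => y ^+ 2)) => e; exact: exprn_continuous.
have [eta] := compact_EVT_min A0 cA (continuous_subspaceT cf).
rewrite inE => -[_ Keta] min_eta; exists eta => // x Kx.
(* A point with more energy than [x0] may leave the box, but then [x0], which lies in it, serves as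
   the comparison. *)
have [xx0|xx0] := leP (\sum_e x e ^+ 2) (\sum_e x0 e ^+ 2).
  by apply: min_eta; rewrite inE; split=> //; exact: smallP.
apply: le_trans (ltW xx0); apply: min_eta; rewrite inE; split=> //; exact: smallP.
Qed.

(** The segment from [eta] to [x] stays in the convex set [BL K], and the energy changes by
    [t * (2 * a + t * S)] along it; small [t] forces [0 <= a]. *)
Lemma BL_energy2_first_order (K : set (E -> R)) (eta x : E -> R) :
    BL K eta -> (forall y, BL K y -> \sum_e eta e ^+ 2 <= \sum_e y e ^+ 2) ->
  BL K x -> \sum_e eta e * eta e <= \sum_e eta e * x e.
Proof.
move=> Keta min_eta Kx.
pose S := \sum_e (x e - eta e) ^+ 2; pose a := \sum_e eta e * (x e - eta e).
have S0 : 0 <= S by apply: sumr_ge0 => e _; exact: sqr_ge0.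
have var t : 0 < t <= 1 -> 0 <= 2 * a + t * S.
  move=> /andP[t0 t1].
  have t1' : 0 <= 1 - t by rewrite subr_ge0.
  have Ky : BL K (fun e => (1 - t) * eta e + t * x e).
    split=> [e|rho Krho]; first by rewrite addr_ge0 ?mulr_ge0 ?Keta.1 ?Kx.1 ?(ltW t0).
    have h1 := Keta.2 _ Krho; have h2 := Kx.2 _ Krho.
    under eq_bigr do rewrite mulrDl -!mulrA.
    rewrite big_split/= -!mulr_sumr.
    by rewrite -[leLHS](subrK t) lerD// -[leLHS]mulr1 ler_wpM2l// ltW.
  have := min_eta _ Ky; rewrite -subr_ge0 -sumrB.
  have -> : \sum_e (((1 - t) * eta e + t * x e) ^+ 2 - eta e ^+ 2) = t * (2 * a + t * S).
    rewrite /a /S !mulr_sumr -big_split/= mulr_sumr.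
    by apply: eq_bigr => e _; ring.
  by rewrite pmulr_rge0.
rewrite -subr_ge0 -sumrB; under eq_bigr do rewrite -mulrBr.
rewrite -/a leNgt; apply/negP => a0.
have aS : 0 < - a + S by rewrite ltr_wpDr// oppr_gt0.
(* If [a < 0], this [t] lies in [(0, 1]], also when [S = 0], and satisfies [t * S <= - a], whence
   [2 * a + t * S <= a < 0]. *)
have := var (- a / (- a + S)).
rewrite divr_gt0 ?oppr_gt0//= ler_pdivrMr// mul1r lerDl S0 => /(_ isT).
apply/negP; rewrite -ltNge.
have h : - a / (- a + S) * S <= - a.
  by rewrite mulrAC ler_pdivrMr// ler_wpM2l ?oppr_ge0 ?(ltW a0)// lerDr oppr_ge0 ltW.
lra.
Qed.

End Minimizer.

(** * Energies on the blocker of the base family *)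

Section BaseModulus.
Variables (R : realType) (E : finType) (M : matroid E).
Local Notation K := (BL (Adm (base_family R M))).
Implicit Types (eta x : E -> R) (B : {set E}).

Lemma BL_indicator_base B : B \in bases M -> K (indicator R B).
Proof.
move=> basB; split=> [e|rho [_ admrho]]; first exact: ler0n.
by apply: admrho; exists B.
Qed.

Lemma sum_indicator (B U : {set E}) :
  \sum_(e in U) indicator R B e = #|B :&: U|%:R.
Proof.
rewrite -sumr_const big_mkcond [RHS]big_mkcond; apply: eq_bigr => e _.
by rewrite !finset.inE /indicator; case: (e \in U); case: (e \in B).
Qed.

(** For positive [n] the indicator of [U] divided by [n] is admissible for the bases; pair [x] with
    it. *)
Lemma BL_base_sum_ge x (U : {set E}) (n : nat) : K x ->
  (forall B, B \in bases M -> (n <= #|B :&: U|)%N) -> n%:R <= \sum_(e in U) x e.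
Proof.
move=> [x0 Kx]; case: n => [|n] leU; first by apply: sumr_ge0 => e _; exact: x0.
have n0 : 0 < n.+1%:R :> R by rewrite ltr0n.
have /Kx : Adm (base_family R M) (fun e => (e \in U)%:R / n.+1%:R).
  split=> [e|_ [B basB <-]]; first by rewrite divr_ge0.
  under eq_bigr do rewrite mulrA.
  rewrite -mulr_suml ler_pdivlMr// mul1r.
  have -> : \sum_e indicator R B e * (e \in U)%:R = \sum_(e in U) indicator R B e.
    rewrite [RHS]big_mkcond; apply: eq_bigr => e _.
    by case: (e \in U); rewrite ?mulr1 ?mulr0.
  by rewrite sum_indicator ler_nat leU.
under eq_bigr do rewrite mulrA.
rewrite -mulr_suml ler_pdivlMr// mul1r => /le_trans; apply.
rewrite [leRHS]big_mkcond ler_sum// => e _.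
by case: (e \in U); rewrite ?mulr1 ?mulr0.
Qed.

(** Tangent inequalities at [eta], summed over the ground set, reduce the claim to [gxeta], obtained
    by comparing both [x] and [eta] with a base of least [eta]-weight. Strictness comes from one
    coordinate where [x] and [eta] differ. *)
Lemma energy2_min_energy_lt eta (s : R) x : 1 < s -> K eta ->
    (forall y, K y -> \sum_e eta e ^+ 2 <= \sum_e y e ^+ 2) ->
  K x -> x <> eta -> energy s eta < energy s x.
Proof.
move=> s1 Keta min_eta Kx x_eta.
have [B basB minB] := min_weight_base M eta.
have level_ge0 y : K y ->
    forall t, 0 <= \sum_(e | t <= eta e) (y e - indicator R B e).
  move=> Ky t; rewrite sumrB subr_ge0.
  have levelE (F : E -> R) : \sum_(e | t <= eta e) F e =
      \sum_(e in [set e | (t <= eta e)%R]%SET) F e.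
    by apply: eq_bigl => e; rewrite finset.inE.
  by rewrite !levelE sum_indicator; apply: BL_base_sum_ge Ky _ => B' /minB.
pose g e := eta e `^ (s - 1).
have s10 : 0 < s - 1 by rewrite subr_gt0.
have gx : 0 <= \sum_e g e * (x e - indicator R B e).
  apply: (sum_monotone_ge0 (level_ge0 _ Kx)) => [e|e f]; first exact: powR_ge0.
  by apply: (ge0_ler_powR (ltW s10)); rewrite nnegrE; exact: Keta.1.
have geta : \sum_e g e * (eta e - indicator R B e) <= 0.
  apply: (sum_monotone_le0 (level_ge0 _ Keta) Keta.1) => [e|e f|]; rewrite /g.
  - by move=> ->; rewrite powR0// gt_eqF.
  - by move=> ->.
  under eq_bigr do rewrite mulrBr.
  (* Minimality of the 2-energy enters only here, tested against the indicator of [B]. *)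
  by rewrite sumrB subr_le0; apply: BL_energy2_first_order Keta min_eta (BL_indicator_base basB).
have gxeta : 0 <= \sum_e s * g e * (x e - eta e).
  under eq_bigr do rewrite -mulrA.
  rewrite -mulr_sumr mulr_ge0 ?(ltW (lt_trans _ s1))//.
  have -> : \sum_e g e * (x e - eta e) =
      \sum_e g e * (x e - indicator R B e) - \sum_e g e * (eta e - indicator R B e).
    by rewrite -sumrB; apply: eq_bigr => e _; ring.
  by rewrite subr_ge0 (le_trans geta).
have [e0 xe0] : exists e, x e <> eta e.
  by apply/existsNP => h; apply: x_eta; apply/funext.
have tangent e : eta e `^ s + s * g e * (x e - eta e) <= x e `^ s.
  have [->|xe] := eqVneq (x e) (eta e); first by rewrite subrr mulr0 addr0.
  by rewrite ltW// powR_gt_tangent ?Keta.1 ?Kx.1.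
apply: (@le_lt_trans _ _ (\sum_e (eta e `^ s + s * g e * (x e - eta e)))).
  by rewrite big_split/= lerDl.
rewrite /energy (bigD1 e0)//= [ltRHS](bigD1 e0)//= ltr_leD ?ler_sum//.
by rewrite powR_gt_tangent ?Keta.1 ?Kx.1//; apply/eqP.
Qed.

End BaseModulus.

(** * From strict minimality to optimal densities *)

Lemma optimal_density_unique (R : realType) (E : finType) (s : R)
    (G : set (E -> R)) (eta : E -> R) : Adm G eta ->
    (forall x, Adm G x -> x <> eta -> energy s eta < energy s x) ->
  forall rho, optimal_density s G rho <-> rho = eta.
Proof.
move=> Geta lt_eta.
have ModE : Mod s G = energy s eta.
  have lb : lbound [set energy s rho | rho in Adm G] (energy s eta).
    move=> _ [x Gx <-]; have [->//|x_eta] := pselect (x = eta).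
    by rewrite ltW// lt_eta.
  apply/eqP; rewrite eq_le; apply/andP; split.
    by apply: ge_inf; [exists (energy s eta) | exists eta].
  by apply: lb_le_inf => //; exists (energy s eta), eta.
move=> rho; split=> [[Grho rhoE]|->]; last by split.
apply: contrapT => rho_eta; have := lt_eta _ Grho rho_eta.
by rewrite rhoE ModE ltxx.
Qed.

Theorem theorem8p1 (R : realType) (E : finType) (M : matroid E)
    (M_loopless : loopless M) (M_rank : (0 < mrank M [set: E]%SET)%N)
    (Bd : set (E -> R)) (Bd_dual : fulkerson_dual (base_family R M) Bd)
    (p q : R) (p_gt1 : 1 < p) (p_neq2 : p <> 2) (q_def : q = p / (p - 1)) :
  exists rho : E -> R,
    (forall rho' : E -> R, optimal_density 2 Bd rho' <-> rho' = rho) /\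
    (forall rho' : E -> R, optimal_density q Bd rho' <-> rho' = rho).
Proof.
have [_ BdE] := Bd_dual.
have [B basB] := bases_nonempty M.
have [eta Keta min_eta] :=
  @BL_energy2_min R E _ (ex_intro _ _ (BL_indicator_base R basB)).
(* The exponent 2 is one more instance of the general [s], so the square [^+ 2] that selects [eta]
   is never converted to the real power in [energy]. *)
have opt s : 1 < s -> forall rho, optimal_density s Bd rho <-> rho = eta.
  move=> s1; apply: optimal_density_unique; rewrite BdE// => x.
  exact: energy2_min_energy_lt.
exists eta; split; apply: opt; first by rewrite ltr1n.
have p1 : 0 < p - 1 by rewrite subr_gt0.
by rewrite q_def ltr_pdivlMr// mul1r gtrBl.
Qed.
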